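(* Let $f \in \mathbb{C}[x_1,\dots,x_n]_d$ with $\underline{\mathsf{WR}}(f) = r$. Then $\mathsf{WR}(f) \le M(r)\cdot d$.
   Context: $\mathsf{WR}(f)$ is the Waring rank: the smallest $s$ with $f=\sum_{k=1}^s\ell_k^d$ for linear forms $\ell_k$. $\underline{\mathsf{WR}}(f)$ is the border Waring rank: the smallest $s$ with $f=\lim_{\epsilon\to0}\sum_{k=1}^s\ell_k(\epsilon)^d$ for linear forms $\ell_k(\epsilon)$ with coefficients rational in $\epsilon$. $\mathsf{maxR}(n,e)=\max\{\mathsf{WR}(h)\mid h\in\mathbb{C}[x_1,\dots,x_n]_e\}$. The partition-maxrank function is $M(r) = \max_{r_1+\dots+r_m = r}\sum_{k=1}^m \mathsf{maxR}(r_k, r_k-1)$, the maximum over all partitions of $r$ into positive integers $r_1,\dots,r_m$.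
   Formalization: The degree d is assumed to be at least 1 (for d = 0 and f = 1 the bound would read 1 ≤ 0), and maxR(n,0), in particular maxR(1,0), is set to 1 by convention, since by the literal definition the maximum over degree-0 forms does not exist. *)

(* Defs.v *)
From HB Require Import structures.
From mathcomp Require Import all_boot all_order all_algebra.
From mathcomp Require Import mpoly.
From mathcomp Require Import complex.
From mathcomp Require Import boolp classical_sets reals filter topology normedtype.
Import numFieldTopology.Exports numFieldNormedType.Exports.
Import GRing.Theory Num.Theory.

Set Implicit Arguments.
Unset Strict Implicit.
Unset Printing Implicit Defensive.

Local Open Scope classical_set_scope.
Local Open Scope ring_scope.

(* The complex numbers are R[i] for R : realType, with the topology of the
   complex modulus (the numField norm). *)
HB.instance Definition _ (R : rcfType) := PseudoPointedMetric.copy R[i] (R[i])^o.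

(* least element of a set of naturals (0 if the set is empty) *)
Definition min_nat (P : nat -> Prop) : nat :=
  xget 0%N [set k | P k /\ forall m, P m -> (k <= m)%N].

(* maximum (= least upper bound) of a set of naturals (0 if unbounded/empty) *)
Definition lub_nat (P : nat -> Prop) : nat :=
  xget 0%N [set k | (forall m, P m -> (m <= k)%N) /\
                    forall b, (forall m, P m -> (m <= b)%N) -> (k <= b)%N].

Section Waring.
Variable R : realType.
Local Notation C := (R[i]).

Definition lin_form (n : nat) (l : 'I_n -> C) : {mpoly C[n]} :=
  \sum_(i < n) l i *: 'X_i.

Definition waring_dec (n d : nat) (h : {mpoly C[n]}) (s : nat) : Prop :=
  exists l : 'I_s -> 'I_n -> C, h = \sum_(k < s) (lin_form (l k)) ^+ d.

Definition WR (n d : nat) (h : {mpoly C[n]}) : nat := min_nat (waring_dec d h).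

(* h = lim_{eps -> 0} sum_{k<s} l_k(eps)^d where the coefficient of x_i in
   l_k(eps) is the rational function p k i / q k i (q k i <> 0); the limit
   is taken in the finite-dimensional space of forms, i.e. coefficientwise. *)
Definition border_waring_dec (n d : nat) (h : {mpoly C[n]}) (s : nat) : Prop :=
  exists p q : 'I_s -> 'I_n -> {poly C},
    (forall k i, q k i != 0) /\
    forall m : 'X_{1..n},
      (\sum_(k < s) (lin_form (fun i => (p k i).[e] / (q k i).[e])) ^+ d)@_m
        @[e --> (0 : C)^'] --> h@_m.

Definition BWR (n d : nat) (h : {mpoly C[n]}) : nat :=
  min_nat (border_waring_dec d h).

(* maxR(n, e) = max { WR(h) | h in C[x_1..x_n]_e }; for e = 0 we use the
   standard convention maxR(n, 0) = 1 (a nonzero constant has rank 1). *)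
Definition maxR (n e : nat) : nat :=
  if e is 0 then 1%N
  else lub_nat (fun w => exists h : {mpoly C[n]}, h \is e.-homog /\ WR e h = w).

Definition Mpart (r : nat) : nat :=
  lub_nat (fun v => exists s : seq nat,
    [/\ all (fun x => 0 < x)%N s, sumn s = r &
        v = sumn [seq maxR x x.-1 | x <- s]]).

End Waring.

(* Main.v *)
Require Import Defs.
From HB Require Import structures.
From mathcomp Require Import all_boot all_order all_algebra.
From mathcomp Require Import cyclic separable cyclotomic zify.
From mathcomp Require Import mpoly.
From mathcomp Require Import complex.
From mathcomp Require Import boolp classical_sets reals filter topology normedtype.
Import Order.TTheory GRing.Theory Num.Theory.
Import numFieldTopology.Exports numFieldNormedType.Exports.

Set Implicit Arguments.
Unset Strict Implicit.
Unset Printing Implicit Defensive.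
Local Open Scope ring_scope.

(** Let f be the limit of sums of r powers l_i(e)^d.  Along an ultrafilter the
projective classes of the l_i(e) converge; group the l_i by these limits, with
q_k of them tending to the class of a linear form P_k.  The limit of a (suitably
rescaled) group of q_k powers is killed by any q_k derivations in directions
orthogonal to P_k.  When d + 1 >= r, nonzero forms with this property for
distinct P_k are linearly independent, so no cancellation occurs between groups
and f is a sum of such limits G_k.  By Euler's identity
G_k = P_k^(d + 1 - q_k) g_k, and g_k is a form of degree q_k - 1 in q_k
variables, because the q_k linear forms of the group live in a q_k-dimensional
space whose orthogonal projector stays bounded.  Writing g_k as a sum of powers
and each product P_k^a m^b as a sum of a + b powers gives the bound.  When
d + 1 < r, the form f depends on r variables and is a derivative of a form of
degree r - 1. *)

(** * Directional derivatives *)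

Section Directional.
Variables (K : numFieldType) (n : nat).
Implicit Types (v a b : 'rV[K]_n) (p q : {mpoly K[n]}).

Definition lf v : {mpoly K[n]} := \sum_i v 0 i *: 'X_i.

Definition dot v a : K := \sum_i v 0 i * a 0 i.

Definition dd a p : {mpoly K[n]} := \sum_i a 0 i *: p^`M(i).

Lemma dd_is_linear a : linear (dd a).
Proof.
move=> c p q; rewrite /dd scaler_sumr -big_split; apply: eq_bigr => i _ /=.
by rewrite linearP scalerDr !scalerA mulrC.
Qed.
HB.instance Definition _ a :=
  GRing.isLinear.Build K {mpoly K[n]} {mpoly K[n]} _ (dd a) (dd_is_linear a).

Lemma ddP c a b p : dd (c *: a + b) p = c *: dd a p + dd b p.
Proof.
rewrite /dd scaler_sumr -big_split; apply: eq_bigr => i _ /=.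
by rewrite !mxE scalerDl scalerA.
Qed.

Lemma ddB a b p : dd (a - b) p = dd a p - dd b p.
Proof. by rewrite addrC -scaleN1r ddP scaleN1r addrC. Qed.

Lemma dd_comm a b p : dd a (dd b p) = dd b (dd a p).
Proof.
have E (c e : 'rV[K]_n) :
    dd c (dd e p) = \sum_i \sum_j (c 0 i * e 0 j) *: p^`M(j)^`M(i).
  rewrite /dd; apply: eq_bigr => i _; rewrite (linear_sum (mderiv i)) scaler_sumr.
  by apply: eq_bigr => j _; rewrite /= mderivZ scalerA.
rewrite !E exchange_big; apply: eq_bigr => i _; apply: eq_bigr => j _.
by rewrite mulrC mderiv_comm.
Qed.

Lemma dd_lfX a v d : dd a (lf v ^+ d) = (d%:R * dot v a) *: lf v ^+ d.-1.
Proof.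
have ddM p q : dd a (p * q) = dd a p * q + p * dd a q.
  rewrite /dd mulr_suml mulr_sumr -big_split; apply: eq_bigr => i _ /=.
  by rewrite mderivM scalerDr scalerAl scalerAr.
have dd1 : dd a (lf v) = (dot v a)%:MP.
  rewrite /dd /dot /lf rmorph_sum; apply: eq_bigr => i _ /=.
  rewrite (raddf_sum (mderiv i)) (bigD1 i) //= big1 ?addr0 => [|j ji].
    rewrite mderivZ mderivX mnm1E eqxx scale1r -mul_mpolyC.
    have -> : (U_(i) - U_(i) = 0 :> 'X_{1..n})%MM by apply/mnmP => k; rewrite !mnmE subnn.
    by rewrite mpolyX0 -mul_mpolyC mulr1 -mpolyCM mulrC.
  by rewrite mderivZ mderivX mnm1E (negPf ji) scale0r scaler0.
elim: d => [|d IHd].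
  by rewrite mul0r scale0r expr0 /dd big1 // => i _; rewrite -mpolyC1 mderivC scaler0.
rewrite exprS ddM dd1 IHd mul_mpolyC -scalerAr /=.
case: d {IHd} => [|d]; first by rewrite !mul0r scale0r addr0 mul1r.
by rewrite /= -exprS -scalerDl [in RHS]mulrSr mulrDl mul1r addrC.
Qed.

Lemma mcoeff_dd a p m : (dd a p)@_m = \sum_i a 0 i * (p@_(m + U_(i)) *+ (m i).+1).
Proof.
rewrite /dd (raddf_sum (mcoeff m)) /=; apply: eq_bigr => i _.
by rewrite mcoeffZ mcoeff_deriv.
Qed.

Lemma dd_homog d a p : p \is d.-homog -> dd a p \is d.-1.-homog.
Proof.
move=> hp; apply/dhomogP => m; rewrite mcoeff_msupp mcoeff_dd => nz.
case: d hp => [|d] hp; last first.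
  apply/eqP/contraT => md; case/eqP: nz; rewrite big1 // => i _.
  by rewrite (dhomog_nemf_coeff hp) ?mul0rn ?mulr0 //= mdegD mdeg1 addn1.
case/eqP: nz; rewrite big1 // => i _.
by rewrite (dhomog_nemf_coeff hp) ?mul0rn ?mulr0 //= mdegD mdeg1 addn1.
Qed.

Lemma lf_homog v : lf v \is 1.-homog.
Proof. by apply: rpred_sum => i _; apply: dhomogZ; rewrite dhomogX /= mdeg1. Qed.

Lemma euler d p : p \is d.-homog -> \sum_i 'X_i * p^`M(i) = d%:R *: p.
Proof.
move=> /dhomogP hp; rewrite [p in RHS]mpolyE scaler_sumr.
under eq_bigr => i _ do rewrite {1}[p]mpolyE (raddf_sum (mderiv i)) mulr_sumr.
rewrite exchange_big /=; apply: eq_big_seq => m mp.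
rewrite -(hp m mp) /= mdegE natr_sum scaler_suml; apply: eq_bigr => i _.
rewrite mderivZ mderivX -!scalerAr [RHS]scalerA [_%:R * _]mulrC -[RHS]scalerA; congr (_ *: _).
have [-> |mi] := posnP (m i); first by rewrite !scale0r.
congr (_ *: _); rewrite -mpolyXD; congr 'X_[_]; apply/mnmP => j; rewrite !mnmE.
by case: eqP => [<-|]; rewrite ?add0n ?subn0 // subnKC.
Qed.

End Directional.
(** * Forms supported at a fat point *)

Section Killed.
Variables (K : numFieldType) (n : nat).
Implicit Types (v a b l : 'rV[K]_n) (p q : {mpoly K[n]}).

Lemma dotP c v a b : dot v (c *: a + b) = c * dot v a + dot v b.
Proof.
rewrite /dot mulr_sumr -big_split; apply: eq_bigr => i _ /=.
by rewrite !mxE mulrDr mulrCA.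
Qed.

Lemma dotB v a b : dot v (a - b) = dot v a - dot v b.
Proof. by rewrite addrC -scaleN1r dotP mulN1r addrC. Qed.

Lemma dotC v a : dot v a = dot a v.
Proof. by apply: eq_bigr => i _; rewrite mulrC. Qed.

Lemma dotZ c v a : dot v (c *: a) = c * dot v a.
Proof. by rewrite -[c *: a]addr0 dotP [X in _ + X]big1 ?addr0 // => i; rewrite mxE mulr0. Qed.

Lemma ddZ c a p : dd (c *: a) p = c *: dd a p.
Proof. by rewrite -[c *: a]addr0 ddP /dd [X in _ + X]big1 ?addr0 // => i; rewrite mxE scale0r. Qed.

Lemma dot_delta v i : dot v (delta_mx 0 i) = v 0 i.
Proof.
rewrite /dot (bigD1 i) //= big1 => [|j ji]; rewrite mxE !eqxx ?mulr1 ?addr0 //.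
by rewrite (negPf ji) mulr0.
Qed.

Lemma dd_delta i p : dd (delta_mx 0 i) p = p^`M(i).
Proof.
rewrite /dd (bigD1 i) //= big1 => [|j ji]; rewrite mxE !eqxx ?scale1r ?addr0 //.
by rewrite (negPf ji) scale0r.
Qed.

Lemma dot_unit v : v != 0 -> exists b, dot v b = 1.
Proof.
case/rV0Pn => i vi; exists ((v 0 i)^-1 *: delta_mx 0 i).
by rewrite dotZ dot_delta mulVf.
Qed.

Lemma dd_eq0 d p : (0 < d)%N -> p \is d.-homog -> (forall a, dd a p = 0) -> p = 0.
Proof.
move=> d0 /euler hp Dp; apply/eqP.
have : d%:R *: p == 0.
  by rewrite -hp big1 // => i _; rewrite -dd_delta Dp mulr0.
by rewrite scaler_eq0 pnatr_eq0 eqn0Ngt d0.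
Qed.

(* For [p] a form of degree [d], this says that [p] is apolar to the [r]-th power
   of the ideal of the point [l]. *)
Fixpoint killed r l p : Prop :=
  if r is r'.+1 then forall a, dot l a = 0 -> killed r' l (dd a p) else p = 0.

Lemma killed_dd r l b p : killed r l p -> killed r l (dd b p).
Proof.
elim: r p => [|r IHr] p /= Hp; first by rewrite Hp raddf0.
by move=> a la; rewrite dd_comm; apply: IHr; apply: Hp.
Qed.

Lemma foldr_dd (s : seq 'rV[K]_n) b p : foldr (@dd K n) (dd b p) s = dd b (foldr (@dd K n) p s).
Proof. by elim: s => //= a s ->; rewrite dd_comm. Qed.

Lemma foldr_dd_sum (s : seq 'rV[K]_n) (I : Type) (t : seq I) (P : pred I) F :
  foldr (@dd K n) (\sum_(i <- t | P i) F i) s = \sum_(i <- t | P i) foldr (@dd K n) (F i) s.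
Proof. by elim: s => //= a s ->; rewrite raddf_sum. Qed.

(** The derivations commute, so the [r] ones in directions orthogonal to [l] may be applied as if
    they came first. *)
Lemma killed_foldr r l s p :
  killed r l p -> (r <= count (fun a => dot l a == 0%R) s)%N -> foldr (@dd K n) p s = 0.
Proof.
elim: s r p => [|b s IHs] r p Hp /=; first by rewrite leqn0 => /eqP r0; rewrite r0 in Hp.
rewrite -foldr_dd; case: eqP => [lb|_].
  case: r Hp => [/= -> _|r Hp]; last by apply: IHs; apply: Hp.
  by apply: (IHs 0%N) => //=; rewrite raddf0.
by rewrite add0n; apply: IHs; apply: killed_dd.
Qed.

(** Such a [p] is a multiple of a power of the linear form [l], and differentiating it along [b]
    with [dot l b = 1] is injective in positive degree: every direction [c] is [dot l c *: b] plus a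
    direction orthogonal to [l]. *)
Lemma homog_foldr_eq0 d l s p :
  p \is d.-homog -> (forall a, dot l a = 0 -> dd a p = 0) ->
  all (fun b => dot l b == 1) s -> (size s <= d)%N -> foldr (@dd K n) p s = 0 -> p = 0.
Proof.
elim: s d p => // b s IHs d p hp Dp /= /andP[/eqP lb ls] sd.
rewrite -foldr_dd => Ds; have d0 : (0 < d)%N by apply: leq_trans sd.
apply: (dd_eq0 d0 hp) => c.
have Db : dd b p = 0.
  apply: (IHs d.-1) => //; first exact: dd_homog.
    by move=> a la; rewrite dd_comm Dp // raddf0.
  by rewrite -ltnS prednK.
rewrite -[c](subrK (dot l c *: b)) addrC ddP Db scaler0 add0r Dp //.
by rewrite dotB dotZ lb mulr1 subrr.
Qed.

(** A derivation orthogonal to [l] lowers both [r] and [d] by one and so preserves the inequality.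
    By induction all such derivatives of [p] vanish, which reduces the claim to
    [homog_foldr_eq0]. *)
Lemma killed_foldr_eq0 d r l s p :
  p \is d.-homog -> killed r l p -> all (fun b => dot l b == 1) s ->
  (r + size s <= d.+1)%N -> foldr (@dd K n) p s = 0 -> p = 0.
Proof.
elim: r d p => // r IHr d p hp Hp ls rd Ds.
(* In degree 0 the inequality forces [s] to be empty, and then [Ds] reads [p = 0]. *)
case: d => [|d] in hp rd.
  by move: rd Ds; rewrite addSn ltnS leqn0 addn_eq0 => /andP[_ /nilP ->].
apply: (@homog_foldr_eq0 d.+1 l s) => //; last first.
  by apply: leq_trans (leq_addl r _) _; rewrite -ltnS -addSn.
move=> a la; apply: (IHr d) => //; first exact: (dd_homog a hp).
- exact: Hp.
- by rewrite foldr_dd Ds raddf0.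
Qed.

(* Differentiating [r j] times along [A j] for every [j != k] annihilates all
   summands but [G k]. *)
Lemma killed_indep (I : finType) d (r : I -> nat) (l : I -> 'rV[K]_n) (G : I -> {mpoly K[n]}) :
  (\sum_i r i <= d.+1)%N -> (forall i, G i \is d.-homog) ->
  (forall i, killed (r i) (l i) (G i)) ->
  (forall j k, j != k -> (0 < r j)%N -> (0 < r k)%N ->
     exists a, dot (l j) a = 0 /\ dot (l k) a = 1) ->
  \sum_i G i = 0 -> forall k, G k = 0.
Proof.
move=> rd hG KG sep sumG k.
have [rk0|rk_gt0] := posnP (r k); first by have := KG k; rewrite rk0.
have exA j : exists a, j != k -> (0 < r j)%N -> dot (l j) a = 0 /\ dot (l k) a = 1.
  have [jk|jk] := eqVneq j k; first by exists 0.
  have [rj|rj] := posnP (r j); first by exists 0.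
  by have [a Ha] := sep j k jk rj rk_gt0; exists a.
have [A HA] := fin_all_exists exA.
pose s := flatten [seq nseq (r j) (A j) | j <- enum I & j != k].
have sz : size s = (\sum_(j | j != k) r j)%N.
  rewrite size_flatten sumnE !big_map big_filter big_enum_cond.
  by apply: eq_bigr => j _; rewrite size_nseq.
(* The length of [s] together with [r k] is the full sum of the [r i], hence at most [d.+1], so that
   the operators in [s] are injective on the forms that [G k] ranges over. *)
apply: (@killed_foldr_eq0 d (r k) (l k) s) => //.
- apply/allP => b /flattenP[t /mapP[j]]; rewrite mem_filter => /andP[jk _] ->.
  by case/nseqP=> -> rj; have [_ ->] := HA j jk rj.
- by move: rd; rewrite sz (bigD1 k).
- have : foldr (@dd K n) (\sum_i G i) s = 0.
    by rewrite sumG; elim: (s) => //= b t ->; rewrite raddf0.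
  rewrite foldr_dd_sum (bigD1 k) //= big1 ?addr0 // => j jk.
  apply: (killed_foldr (KG j)); rewrite count_flatten sumnE !big_map big_filter.
  rewrite big_enum_cond (bigD1 j) //= count_nseq.
  have [-> //|rj] := posnP (r j); have [-> _] := HA j jk rj.
  by rewrite eqxx mul1n leq_addr.
Qed.

(** Euler's identity is split along [b]: a multiple of [p] is [lf l * dd b p] plus the sum of the
    products of ['X_i] with the derivative along [delta_mx 0 i - l 0 i *: b]. The first derivative
    loses one power of [lf l], regained by the factor; the others are orthogonal to [l] and so lower
    [r] together with the degree. *)
Lemma killed_div d r l b p :
  dot l b = 1 -> (r <= d.+1)%N -> p \is d.-homog -> killed r l p ->
  exists2 g, g \is r.-1.-homog & p = lf l ^+ (d.+1 - r) * g.
Proof.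
move=> lb; elim: d r p => [|d IHd] r p rd hp Kp.
  case: r rd Kp => [|[|//]] _ Kp; last by exists p; rewrite ?expr0 ?mul1r.
  by exists 0; rewrite ?rpred0 // mulr0.
case: r rd Kp => [|r] rd Kp; first by exists 0; rewrite ?rpred0 // mulr0.
have [rd'|rd'] := ltnP d r.
  have -> : r = d.+1 by apply/eqP; rewrite eqn_leq rd' andbT.
  by exists p; rewrite ?subnn ?mul1r.
have [gb hgb Egb] := IHd r.+1 (dd b p) rd' (dd_homog b hp) (killed_dd b Kp).
(* Homogeneity is asked of ['X_i * g], which covers [r = 0]: there the derivative is zero and the
   truncated degree [r.-1] of [g] would be off by one. *)
have /fin_all_exists2[g hg Eg] : forall i : 'I_n,
    exists2 g, 'X_i * g \is r.-homog & dd (delta_mx 0 i - l 0 i *: b) p = lf l ^+ (d.+2 - r.+1) * g.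
  move=> i; have {}Kp : killed r l (dd (delta_mx 0 i - l 0 i *: b) p).
    by apply: Kp; rewrite dotB dotZ lb dot_delta mulr1 subrr.
  case: r Kp {rd hgb Egb} rd' => [/= -> _|r Kp rd'].
    exists 0; first by rewrite mulr0 rpred0.
    by rewrite mulr0.
  have [g hg ->] := IHd r.+1 _ (leqW rd') (dd_homog _ hp) Kp.
  by exists g => //; rewrite -[r.+1]add1n; apply: dhomogM => //; rewrite dhomogX /= mdeg1.
exists (d.+1%:R^-1 *: (gb + \sum_i 'X_i * g i)).
  by apply: rpredZ; apply: rpredD => //; apply: rpred_sum => i _; exact: hg.
apply: (@scalerI _ _ (d.+1%:R : K)); first by rewrite pnatr_eq0.
rewrite -(euler hp) scalerAr scalerA divff ?pnatr_eq0 // scale1r mulrDr mulr_sumr.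
transitivity (lf l * dd b p + \sum_i 'X_i * dd (delta_mx 0 i - l 0 i *: b) p).
  rewrite /lf mulr_suml -big_split; apply: eq_bigr => i _ /=.
  by rewrite ddB dd_delta ddZ mulrBr -scalerAr -scalerAl addrC subrK.
rewrite Egb mulrA -exprS -subSn //; congr (_ + _); apply: eq_bigr => i _.
by rewrite Eg mulrCA.
Qed.

End Killed.

(** * Substitutions and sums of powers *)

Section PowerSums.
Variable K : numClosedFieldType.
Implicit Types (n d : nat).
Local Open Scope sesquilinear_scope.

Lemma lfZ n c (v : 'rV[K]_n) : lf (c *: v) = c *: lf v.
Proof. by rewrite /lf scaler_sumr; apply: eq_bigr => i _; rewrite mxE scalerA. Qed.

Lemma lfD n (u v : 'rV[K]_n) : lf (u + v) = lf u + lf v.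
Proof. by rewrite /lf -big_split; apply: eq_bigr => i _; rewrite mxE scalerDl. Qed.

Lemma lf0 n : lf (0 : 'rV[K]_n) = 0.
Proof. by rewrite -(scale0r 0) lfZ scale0r. Qed.

Lemma lf_delta n i : lf (delta_mx 0 i : 'rV[K]_n) = 'X_i.
Proof.
rewrite /lf (bigD1 i) //= big1 => [|j ji]; rewrite mxE !eqxx ?scale1r ?addr0 //.
by rewrite (negPf ji) scale0r.
Qed.

Lemma lfX_homog n (v : 'rV[K]_n) d : lf v ^+ d \is d.-homog.
Proof. by have := dhomogMn d (lf_homog v); rewrite mul1n. Qed.

Lemma lf_eq0 n (v : 'rV[K]_n) : lf v = 0 -> v = 0.
Proof.
move=> v0; apply/rowP => i; rewrite mxE; have := congr1 (mcoeff U_(i)) v0.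
rewrite mcoeff0 /lf (raddf_sum (mcoeff _)) (bigD1 i) //= big1 => [|j ji].
  by rewrite addr0 mcoeffZ mcoeffXU eqxx mulr1.
by rewrite mcoeffZ mcoeffXU (negPf ji) mulr0.
Qed.

Definition sub n k (B : 'M[K]_(n, k)) (p : {mpoly K[n]}) : {mpoly K[k]} :=
  p \mPo [tuple lf (row i B) | i < n].

Lemma sub_lf n k (B : 'M[K]_(n, k)) v : sub B (lf v) = lf (v *m B).
Proof.
rewrite /sub /lf raddf_sum /=.
under eq_bigr => i _ do
  rewrite comp_mpolyZ comp_mpolyXU -tnth_nth tnth_map tnth_ord_tuple /lf scaler_sumr.
rewrite exchange_big; apply: eq_bigr => j _ /=; rewrite mxE scaler_suml.
by apply: eq_bigr => i _; rewrite !mxE scalerA.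
Qed.

Lemma subM n k (B : 'M[K]_(n, k)) p q : sub B (p * q) = sub B p * sub B q.
Proof. exact: rmorphM. Qed.

Lemma subZ n k (B : 'M[K]_(n, k)) c p : sub B (c *: p) = c *: sub B p.
Proof. exact: linearZ. Qed.

Lemma subXn n k (B : 'M[K]_(n, k)) p d : sub B (p ^+ d) = sub B p ^+ d.
Proof. exact: rmorphXn. Qed.

Lemma sub_sum n k (B : 'M[K]_(n, k)) (I : Type) (s : seq I) (P : pred I) F :
  sub B (\sum_(i <- s | P i) F i) = \sum_(i <- s | P i) sub B (F i).
Proof. exact: raddf_sum. Qed.

Lemma sub_X n k (B : 'M[K]_(n, k)) m : sub B 'X_[m] = \prod_i lf (row i B) ^+ m i.
Proof.
by rewrite /sub comp_mpolyX; apply: eq_bigr => i _; rewrite tnth_map tnth_ord_tuple.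
Qed.

Lemma sub_sub n k l (B : 'M[K]_(n, k)) (B' : 'M[K]_(k, l)) p :
  sub B' (sub B p) = sub (B *m B') p.
Proof.
rewrite [p]mpolyE (sub_sum B) (sub_sum B') (sub_sum (B *m B')).
apply: eq_bigr => m _; rewrite !subZ !sub_X.
congr (_ *: _); rewrite [LHS](rmorph_prod (comp_mpoly _)); apply: eq_bigr => i _.
by rewrite [LHS]subXn [sub _ _]sub_lf row_mul.
Qed.

Lemma prod_homog n (I : Type) (s : seq I) (e : I -> nat) (F : I -> {mpoly K[n]}) :
  (forall i, F i \is (e i).-homog) -> \prod_(i <- s) F i \is (\sum_(i <- s) e i).-homog.
Proof.
move=> hF; elim: s => [|i s IHs]; first by rewrite !big_nil dhomog1.
by rewrite !big_cons; apply: dhomogM.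
Qed.

Lemma sub_homog n k (B : 'M[K]_(n, k)) d p : p \is d.-homog -> sub B p \is d.-homog.
Proof.
move=> /dhomogP hp; rewrite [p]mpolyE sub_sum big_seq; apply: rpred_sum => m mp.
rewrite subZ; apply: rpredZ; rewrite -(hp m mp) sub_X /= mdegE.
by apply: prod_homog => i; exact: lfX_homog.
Qed.

(** The linear forms are kept in a sequence so that adding two decompositions is concatenation. *)
Definition powsum n d (h : {mpoly K[n]}) N :=
  exists2 s : seq 'rV[K]_n, size s = N & h = \sum_(v <- s) lf v ^+ d.

Lemma powsum0 n d : powsum d (0 : {mpoly K[n]}) 0.
Proof. by exists [::]; rewrite ?big_nil. Qed.

Lemma powsumD n d (g h : {mpoly K[n]}) M N :
  powsum d g M -> powsum d h N -> powsum d (g + h) (M + N).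
Proof.
by move=> [s <- ->] [t <- ->]; exists (s ++ t); rewrite ?size_cat ?big_cat.
Qed.

Lemma powsum_sum n d (I : Type) (s : seq I) (P : pred I) (F : I -> {mpoly K[n]}) N :
  (forall i, P i -> powsum d (F i) (N i)) ->
  powsum d (\sum_(i <- s | P i) F i) (\sum_(i <- s | P i) N i).
Proof.
by move=> HF; elim/big_rec2: _ => [|i y1 y2 Pi]; [exact: powsum0 | apply: powsumD; exact: HF].
Qed.

(** The decomposition is padded with zero forms, whose powers vanish only for [0 < d]. *)
Lemma powsumW n d (h : {mpoly K[n]}) M N :
  (0 < d)%N -> (M <= N)%N -> powsum d h M -> powsum d h N.
Proof.
move=> d0 + [s sM ->]; rewrite -{}sM => MN; exists (s ++ nseq (N - size s) 0).
  by rewrite size_cat size_nseq subnKC.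
rewrite big_cat /= [X in _ + X]big1_seq ?addr0 // => v /andP[_ /nseqP[-> _]].
by rewrite lf0 expr0n eqn0Ngt d0.
Qed.

Lemma powsum_lf n d (v : 'rV[K]_n) : powsum d (lf v ^+ d) 1.
Proof. by exists [:: v]; rewrite ?big_seq1. Qed.

Lemma powsumZ n d c (h : {mpoly K[n]}) N :
  (0 < d)%N -> powsum d h N -> powsum d (c *: h) N.
Proof.
move=> d0 [s <- ->]; exists [seq (d.-root c) *: v | v <- s]; first by rewrite size_map.
rewrite big_map scaler_sumr; apply: eq_bigr => v _.
by rewrite lfZ exprZn rootCK.
Qed.

Lemma powsum_sub n k (B : 'M[K]_(n, k)) d h N : powsum d h N -> powsum d (sub B h) N.
Proof.
move=> [s <- ->]; exists [seq v *m B | v <- s]; first by rewrite size_map.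
by rewrite big_map sub_sum; apply: eq_bigr => v _; rewrite subXn sub_lf.
Qed.

Lemma powsum_dd n d (a : 'rV[K]_n) h N :
  (0 < d)%N -> powsum d.+1 h N -> powsum d (dd a h) N.
Proof.
move=> d0 [s <- ->]; rewrite raddf_sum -sum1_size.
by apply: powsum_sum => v _; rewrite /= dd_lfX; apply: powsumZ => //; exact: powsum_lf.
Qed.

(** In characteristic zero ['X^d - 1] is separable, so it has [d] distinct roots, and these include
    a primitive one. *)
Lemma prim_root_exists d : (0 < d)%N -> exists z : K, d.-primitive_root z.
Proof.
pose p : {poly K} := 'X^d - 1; have [r Dp] := closed_field_poly_normal p.
move=> d_gt0; rewrite (monicP _) ?monicXnsubC // scale1r in Dp.
have rn1: all d.-unity_root r by apply/allP=> z; rewrite -root_prod_XsubC -Dp.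
have sz_r: (d < (size r).+1)%N.
  by rewrite -(size_prod_XsubC r id) -Dp size_XnsubC.
have [|z] := hasP (has_prim_root d_gt0 rn1 _ sz_r); last by exists z.
by rewrite -separable_prod_XsubC -Dp separable_Xn_sub_1 // pnatr_eq0 -lt0n.
Qed.

Lemma sum_prim_root d (z : K) m : d.-primitive_root z ->
  \sum_(j < d) z ^+ (j * m) = if (d %| m)%N then d%:R else 0.
Proof.
move=> pz; have zm : \sum_(j < d) z ^+ (j * m) = \sum_(j < d) (z ^+ m) ^+ j.
  by apply: eq_bigr => j _; rewrite mulnC exprM.
rewrite zm (prim_order_dvd pz); case: eqP => [->|/eqP z1].
  by under eq_bigr do rewrite expr1n; rewrite sumr_const card_ord.
apply/eqP; have : (z ^+ m - 1) * \sum_(j < d) (z ^+ m) ^+ j == 0.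
  by rewrite -subrX1 -exprM mulnC exprM (prim_expr_order pz) expr1n subrr.
by rewrite mulf_eq0 subr_eq0 (negPf z1).
Qed.

(* Averaging [z ^+ a * (x + z y) ^+ (a + b)] over the roots of unity [z] of
   order [a + b] isolates the monomial [x ^+ a * y ^+ b]. *)
Lemma powsum_binary n (u v : 'rV[K]_n) a b :
  (0 < a + b)%N -> powsum (a + b) (lf u ^+ a * lf v ^+ b) (a + b).
Proof.
(* Pure powers are set apart: for them the averaging would retain both extreme terms of the binomial
   expansion. *)
case: a => [|a] ab; first by rewrite mul1r; apply: powsumW (powsum_lf _ _).
case: b ab => [|b] ab; first by rewrite mulr1 addn0; apply: powsumW (powsum_lf _ _).
set d := (a.+1 + b.+1)%N in ab *; have [z pz] := prim_root_exists ab.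
have -> : lf u ^+ a.+1 * lf v ^+ b.+1 =
    \sum_(j < d) ((z ^+ (j * a.+1) / (d * 'C(d, b.+1))%:R) *: lf (u + z ^+ j *: v) ^+ d).
  under eq_bigr => j _ do rewrite lfD lfZ exprDn scaler_sumr.
  rewrite exchange_big (bigD1 (inord b.+1)) //=.
  have bd : (b.+1 < d.+1)%N by rewrite ltnS leq_addl.
  have E (i : 'I_d.+1) : \sum_(j < d) z ^+ (j * a.+1) / (d * 'C(d, b.+1))%:R *:
      (lf u ^+ (d - i) * (z ^+ j *: lf v) ^+ i *+ 'C(d, i)) =
      ((\sum_(j < d) z ^+ (j * (a.+1 + i))) * ('C(d, i)%:R / (d * 'C(d, b.+1))%:R)) *:
      (lf u ^+ (d - i) * lf v ^+ i).
    rewrite mulr_suml scaler_suml; apply: eq_bigr => j _.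
    rewrite exprZn -scalerAr -[_ *+ 'C(d, i)]scaler_nat !scalerA -exprM mulnDr exprD; congr (_ *: _).
    by rewrite [LHS]mulrAC -!mulrA; congr (_ * _); rewrite mulrC -!mulrA.
  rewrite E [X in _ + X]big1 ?addr0 => [|i ib].
    rewrite sum_prim_root // inordK // dvdnn mulrA -natrM divff ?scale1r ?addnK //.
    by rewrite pnatr_eq0 muln_eq0 negb_or -!lt0n ab bin_gt0.
  rewrite E sum_prim_root // ifN ?mul0r ?scale0r //.
  (* Here [a.+1 + i = q * d] with [i <= d]. The quotient 0 is impossible, 1 gives [i = b.+1], and 2
     or more would force [d <= a.+1]. *)
  apply: contra ib => /dvdnP[q]; rewrite -val_eqE /= inordK //.
  case: q => [|[|q]] //; first by rewrite mul1n => /addnI ->.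
  have := ltn_ord i; rewrite ltnS => id E2.
  have : (d + d <= a.+1 + d)%N.
    apply: (@leq_trans (a.+1 + i)%N); last by rewrite leq_add2l.
    by rewrite E2 !mulSn addnA leq_addr.
  by rewrite leq_add2r /d -[X in (_ <= X)%N]addn0 leq_add2l.
rewrite -[X in powsum _ _ X](card_ord d) -sum1_card; apply: powsum_sum => j _.
exact: powsumZ (powsum_lf _ _).
Qed.

Lemma powsum_mul n a b (h : {mpoly K[n]}) v N :
  (0 < a + b)%N -> powsum a h N -> powsum (a + b) (h * lf v ^+ b) (N * (a + b)).
Proof.
move=> ab [s <- ->]; rewrite mulr_suml -sum1_size big_distrl /=.
by apply: powsum_sum => u _; rewrite mul1n; exact: powsum_binary.
Qed.

Lemma powsum_prod n (s : seq 'rV[K]_n) :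
  (0 < size s)%N -> powsum (size s) (\prod_(v <- s) lf v) (size s)`!.
Proof.
elim: s => //= v [|u s] IHs _; first by rewrite big_seq1; exact: powsum_lf.
rewrite big_cons mulrC -[lf v]expr1 -addn1 addn1 factS mulnC -addn1.
by apply: powsum_mul; rewrite ?addn1 //; exact: IHs.
Qed.

Lemma homog_msize_le n d (h : {mpoly K[n]}) : h \is d.-homog -> (msize h <= d.+1)%N.
Proof.
move=> /dhomogP hh; rewrite mmeasureE; apply/bigmax_leqP_seq => m mh _.
by rewrite ltnS (hh m mh).
Qed.

(** A crude uniform bound, monomial by monomial. It ensures that [WR] is a true minimum and [maxR] a
    true maximum rather than the default value 0. *)
Lemma homog_powsum_bound n d : (0 < d)%N ->
  exists N, forall h : {mpoly K[n]}, h \is d.-homog -> powsum d h N.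
Proof.
move=> d0; exists (\sum_(m : 'X_{1..n < d.+1}) d`!)%N => h hh.
rewrite (mpolywE (homog_msize_le hh)); apply: powsum_sum => m _.
have [hm|hm] := eqVneq (mdeg m) d; last first.
  by rewrite (dhomog_nemf_coeff hh) // scale0r; apply: powsumW (powsum0 _ _).
apply: powsumZ => //; rewrite mpolyXE_id.
pose s := flatten [seq nseq (m i) (delta_mx 0 i : 'rV[K]_n) | i <- index_enum 'I_n].
have ss : size s = d.
  rewrite size_flatten sumnE !big_map -[RHS]hm mdegE.
  by apply: eq_bigr => j _; rewrite size_nseq.
have -> : \prod_(i < n) 'X_i ^+ m i = \prod_(v <- s) lf v.
  rewrite /s big_flatten big_map /=; apply: eq_bigr => i _.
  by rewrite big_nseq lf_delta iter_mulr_1.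
by rewrite -[X in powsum X]ss -[in X in powsum _ _ X]ss; apply: powsum_prod; rewrite ss.
Qed.

(* Write [V] in an orthonormal basis of its row space. *)
Lemma compression r n (V : 'M[K]_(r, n)) :
  exists (B' : 'M[K]_(n, r)) (B : 'M[K]_(r, n)),
    [/\ forall i j, `|B' i j| <= 1, forall i j, `|B i j| <= 1 & V *m (B' *m B) = V].
Proof.
set q := \rank V; have qn : (q <= n)%N := rank_leq_col V.
have qr : (q <= r)%N := rank_leq_row V.
pose S := schmidt (row_base V); have uS : S \is unitarymx by exact: schmidt_unitarymx.
(* The squared modulus of an entry is at most the squared norm of its row, which is 1. *)
have S1 i j : `|S i j| <= 1.
  rewrite -(@ler_pXn2r _ 2) ?nnegrE // expr1n.
  have /unitarymxP/matrixP/(_ i i) := uS; rewrite !mxE eqxx mulr1n => <-.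
  rewrite (bigD1 j) //= !mxE -normCK lerDl; apply: sumr_ge0 => k _.
  by rewrite !mxE -normCK exprn_ge0.
(* The basis is padded with zeros from [q] to [r] vectors, so that the matrix sizes do not depend on
   the rank of [V]. *)
pose P : 'M[K]_(r, q) := pid_mx q; pose P' : 'M[K]_(q, r) := pid_mx q.
have P'P : P' *m P = 1%:M by rewrite pid_mx_id // pid_mx_1.
exists (S^t* *m P'), (P *m S); split.
- move=> i j; rewrite mxE; have [jq|jq] := ltnP j q.
    rewrite (bigD1 (Ordinal jq)) //= big1 ?addr0 => [|k kj].
      by rewrite !mxE /= eqxx jq mulr1 norm_conjC.
    by rewrite !mxE -val_eqE /= in kj *; rewrite (negPf kj) mulr0.
  rewrite big1 ?normr0 ?ler01 // => k _; rewrite !mxE.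
  by rewrite ltn_eqF ?mulr0 //; apply: leq_trans (ltn_ord k) jq.
- move=> i j; rewrite mxE; have [iq|iq] := ltnP i q.
    rewrite (bigD1 (Ordinal iq)) //= big1 ?addr0 => [|k kj].
      by rewrite !mxE /= eqxx iq mul1r.
    by rewrite !mxE -val_eqE /= eq_sym in kj *; rewrite (negPf kj) mul0r.
  rewrite big1 ?normr0 ?ler01 // => k _; rewrite !mxE.
  by rewrite gtn_eqF ?mul0r //; apply: leq_trans (ltn_ord k) iq.
have -> : S^t* *m P' *m (P *m S) = S^t* *m S.
  by rewrite mulmxA -(mulmxA _ P' P) P'P mulmx1.
have /submxP[X VX] : (V <= S)%MS.
  by rewrite -(eq_row_base V); exact: schmidt_sub.
by have := congr1 (fun W => W *m S^t* *m S) VX; rewrite mulmxA mulmxtVK -?VX.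
Qed.

End PowerSums.

(** * Rank of a single local form, integration, normalization of vectors *)

Section Local.
Variable K : numClosedFieldType.

(** The value at 1 is treated apart because it concerns degree 0, where a sum of powers is a natural
    number and cannot be an arbitrary constant. *)
Definition local_bound (N : nat -> nat) :=
  (0 < N 1)%N /\
  forall q (h : {mpoly K[q]}), (1 < q)%N -> h \is q.-1.-homog -> powsum q.-1 h (N q).

(** By [killed_div], [p] is [lf l ^+ (d.+1 - q) * g] with [g] of degree [q.-1]. Once [g] is known to
    come from [q] variables it is a sum of [N q] powers, and multiplying each by the power of [lf l]
    costs a factor [d]. *)
Lemma local_rank N n d q (l : 'rV[K]_n) (B' : 'M[K]_(n, q)) (B : 'M[K]_(q, n)) p :
  local_bound N -> (0 < d)%N -> (0 < q <= d.+1)%N -> l != 0 -> p \is d.-homog ->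
  killed q l p -> sub (B' *m B) p = p -> l *m (B' *m B) = l -> powsum d p (N q * d).
Proof.
move=> [N1 HN] d0 /andP[q0 qd] l0 hp Kp Bp Bl; have [b lb] := dot_unit l0.
have [g hg Ep] := killed_div lb qd hp Kp.
have lf0 : lf l ^+ (d.+1 - q) != 0.
  by rewrite expf_neq0 //; apply: contra_neq l0; apply: lf_eq0.
(* The substitution fixes both [p] and [lf l], and the power of [lf l] can be cancelled because
   polynomials form a domain. *)
have Eg : sub B (sub B' g) = g.
  by apply: (mulfI lf0); rewrite sub_sub -Ep -[in RHS]Bp Ep subM subXn sub_lf Bl.
have [q1|q1] := ltnP 1 q.
  have := powsum_sub B (HN q _ q1 (sub_homog B' hg)); rewrite Eg => Hg.
  have qd' : (q.-1 + (d.+1 - q) = d)%N by lia.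
  by have := @powsum_mul K n q.-1 (d.+1 - q) g l (N q); rewrite qd' -mulrC -Ep; apply.
(* For [q = 1] the cofactor [g] is a constant, so [p] is a scalar multiple of [lf l ^+ d], hence a
   single power. *)
have Eq1 : q = 1%N by apply/eqP; rewrite eqn_leq q1.
rewrite Eq1 in hg Ep *; rewrite subn1 /= in Ep.
have Ec : g = (mcoeff 0%MM g)%:MP.
  apply/mpolyP => m; rewrite mcoeffC; have [->|m0] := eqVneq m 0%MM; first by rewrite mulr1.
  by rewrite mulr0 (dhomog_nemf_coeff hg) //= mdeg_eq0.
rewrite Ep Ec mulrC mul_mpolyC; apply: (powsumW d0 (M := 1)); first by rewrite muln_gt0 N1.
by apply: powsumZ => //; apply: powsum_lf.
Qed.

Lemma antiderivative n (i : 'I_n) d (p : {mpoly K[n]}) :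
  p \is d.-homog -> exists2 q, q \is d.+1.-homog & q^`M(i) = p.
Proof.
move=> /dhomogP hp.
exists (\sum_(m <- msupp p) (p@_m / (m i).+1%:R) *: 'X_[m + U_(i)]).
  rewrite big_seq; apply: rpred_sum => m mp; apply: rpredZ.
  by rewrite dhomogX /= mdegD mdeg1 addn1 eqSS; apply/eqP/hp.
rewrite (raddf_sum (mderiv i)) [RHS]mpolyE; apply: eq_bigr => m _ /=.
rewrite mderivZ mderivX scalerA addmK mnmDE mnm1E eqxx addn1 divfK //.
by rewrite pnatr_eq0.
Qed.

(** A form is integrated [k] times in the variable [i], decomposed, and differentiated back: the
    derivative of a power is a multiple of a power. *)
Lemma powsum_integral n (i : 'I_n) d k N :
  (0 < d)%N -> (forall h : {mpoly K[n]}, h \is (d + k).-homog -> powsum (d + k) h N) ->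
  forall h : {mpoly K[n]}, h \is d.-homog -> powsum d h N.
Proof.
move=> d0; elim: k => [|k IHk]; first by rewrite addn0.
rewrite addnS => HN; apply: IHk => h hh; have [q hq <-] := antiderivative i hh.
by rewrite -dd_delta; apply: powsum_dd; [rewrite addn_gt0 d0 | apply: HN].
Qed.

(** A representative of the projective class of [a] on a compact set that avoids zero. The zero
    vector gets the coefficient 0 and an arbitrary unit vector. *)
Lemma normalize n (a : 'rV[K]_n) : (0 < n)%N ->
  exists cv : K * 'rV[K]_n, a = cv.1 *: cv.2 /\ \sum_j `|cv.2 0 j| = 1.
Proof.
case: n a => // n a _; have [-> |a0] := eqVneq a 0.
  exists (0, delta_mx 0 ord0); split; first by rewrite scale0r.
  rewrite (bigD1 ord0) //= big1 => [|j j0]; rewrite mxE !eqxx ?normr1 ?addr0 //.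
  by rewrite (negPf j0) normr0.
pose s := \sum_j `|a 0 j|; have s0 : s != 0.
  apply: contraNneq a0 => s0; apply/eqP/rowP => j; rewrite mxE; apply/eqP.
  rewrite -normr_eq0; move/eqP: s0; rewrite psumr_eq0 // => /allP/(_ j).
  by apply; rewrite mem_index_enum.
exists (s, s^-1 *: a); split; first by rewrite scalerA divff // scale1r.
under eq_bigr do rewrite mxE normrM.
rewrite -mulr_sumr normfV ger0_norm; last by apply: sumr_ge0.
by rewrite mulVf.
Qed.

End Local.

(** * Limits of forms *)

Definition tends {K : numFieldType} {T : Type} (U : set_system T) (z : T -> K) (l : K) : Prop :=
  (z @ U --> l)%classic.

Section Limits.
Local Open Scope classical_set_scope.
Variables (K : numClosedFieldType) (T : Type) (U : set_system T).
Context (FU : ProperFilter U).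
Implicit Types (f g : T -> K).

Lemma tends_uniq f (a b : K) : tends U f a -> tends U f b -> a = b.
Proof. exact: (cvg_unique (@norm_hausdorff K K)). Qed.

Lemma tends_cst (a : K) : tends U (fun=> a) a.
Proof. exact: cvg_cst. Qed.
Arguments tends_cst : clear implicits.

Lemma tendsD f g (a b : K) :
  tends U f a -> tends U g b -> tends U (fun t => f t + g t) (a + b).
Proof. exact: cvgD. Qed.

Lemma tendsB f g (a b : K) :
  tends U f a -> tends U g b -> tends U (fun t => f t - g t) (a - b).
Proof. exact: cvgB. Qed.

Lemma tendsM f g (a b : K) :
  tends U f a -> tends U g b -> tends U (fun t => f t * g t) (a * b).
Proof. exact: cvgM. Qed.

Lemma tendsV f (a : K) : a != 0 -> tends U f a -> tends U (fun t => (f t)^-1) a^-1.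
Proof. exact: cvgV. Qed.

Lemma tends_norm f (a : K) : tends U f a -> tends U (fun t => `|f t|) `|a|.
Proof. exact: cvg_norm. Qed.

Lemma tends_near f g (a : K) : (\forall t \near U, f t = g t) -> tends U f a -> tends U g a.
Proof. by move=> fg; apply: cvg_trans; apply: near_eq_cvg. Qed.

Lemma tends_ext f g (a : K) : f =1 g -> tends U f a -> tends U g a.
Proof. by move=> /funext ->. Qed.

Lemma tends_sum (I : Type) (s : seq I) (P : pred I) (f : I -> T -> K) (a : I -> K) :
  (forall i, P i -> tends U (f i) (a i)) ->
  tends U (fun t => \sum_(i <- s | P i) f i t) (\sum_(i <- s | P i) a i).
Proof.
move=> fa; elim: s => [|i s IHs].
  rewrite big_nil; apply: (@tends_ext (fun=> 0)); last exact: tends_cst.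
  by move=> t; rewrite big_nil.
rewrite big_cons; case: ifP => Pi.
  apply: (tends_ext _ (tendsD (fa i Pi) IHs)) => t.
  by rewrite big_cons Pi.
by apply: (tends_ext _ IHs) => t; rewrite big_cons Pi.
Qed.

Lemma tends_near_neq0 (z : T -> K) a : a != 0 -> tends U z a -> \forall t \near U, z t != 0.
Proof. by move=> a0 /cvgr_neq0; apply. Qed.

Lemma tendsMn (z : T -> K) a k : tends U z a -> tends U (fun t => z t *+ k) (a *+ k).
Proof.
move=> za; rewrite -mulr_natr; apply: (tends_ext _ (tendsM za (tends_cst _))) => t.
by rewrite mulr_natr.
Qed.

Definition mtends m n (A : T -> 'M[K]_(m, n)) (B : 'M[K]_(m, n)) : Prop :=
  forall i j, tends U (fun t => A t i j) (B i j).

(** Coefficientwise convergence puts no bound on degrees; statements that need one, such as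
    [ptends_sub], assume homogeneity of a fixed degree. *)
Definition ptends n (F : T -> {mpoly K[n]}) (G : {mpoly K[n]}) : Prop :=
  forall m, tends U (fun t => (F t)@_m) G@_m.

Lemma mtends_uniq m n (A : T -> 'M[K]_(m, n)) B B' : mtends A B -> mtends A B' -> B = B'.
Proof. by move=> AB AB'; apply/matrixP => i j; apply: tends_uniq (AB i j) (AB' i j). Qed.

Lemma mtends_mul m n k (A : T -> 'M[K]_(m, n)) (B : T -> 'M[K]_(n, k)) A' B' :
  mtends A A' -> mtends B B' -> mtends (fun t => A t *m B t) (A' *m B').
Proof.
move=> AA BB i j; rewrite mxE; apply: (@tends_ext (fun t => \sum_k A t i k * B t k j)).
  by move=> t; rewrite mxE.
by apply: tends_sum => l _; apply: tendsM.
Qed.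

Lemma tends_dot n (v : T -> 'rV[K]_n) v' (a : 'rV[K]_n) :
  mtends v v' -> tends U (fun t => dot (v t) a) (dot v' a).
Proof. by move=> vv; apply: tends_sum => i _; apply: tendsM => //; apply: tends_cst. Qed.

Lemma ptends_uniq n (F : T -> {mpoly K[n]}) G G' : ptends F G -> ptends F G' -> G = G'.
Proof. by move=> FG FG'; apply/mpolyP => m; apply: tends_uniq (FG m) (FG' m). Qed.

Lemma ptends_ext n (F F' : T -> {mpoly K[n]}) G : F =1 F' -> ptends F G -> ptends F' G.
Proof. by move=> /funext ->. Qed.

Lemma ptends_cst n (G : {mpoly K[n]}) : ptends (fun=> G) G.
Proof. by move=> m; apply: tends_cst. Qed.

Arguments ptends_cst : clear implicits.
Arguments ptends_cst {n} G.

Lemma ptends_sum n (I : Type) (s : seq I) (P : pred I) (F : I -> T -> {mpoly K[n]}) G :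
  (forall i, P i -> ptends (F i) (G i)) ->
  ptends (fun t => \sum_(i <- s | P i) F i t) (\sum_(i <- s | P i) G i).
Proof.
move=> FG m; rewrite (raddf_sum (mcoeff m)).
apply: (@tends_ext (fun t => \sum_(i <- s | P i) (F i t)@_m)).
  by move=> t; rewrite (raddf_sum (mcoeff m)).
by apply: tends_sum => i Pi; apply: FG.
Qed.

Lemma ptendsZ n (c : T -> K) (F : T -> {mpoly K[n]}) c' G :
  tends U c c' -> ptends F G -> ptends (fun t => c t *: F t) (c' *: G).
Proof.
move=> cc FG m; rewrite mcoeffZ.
by apply: (tends_ext _ (tendsM cc (FG m))) => t; rewrite mcoeffZ.
Qed.

Lemma ptendsM n (F F' : T -> {mpoly K[n]}) G G' :
  ptends F G -> ptends F' G' -> ptends (fun t => F t * F' t) (G * G').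
Proof.
move=> FG FG' m; rewrite mcoeffM.
pose S t := \sum_(k : 'X_{1..n < (mdeg m).+1, (mdeg m).+1} | m == (k.1 + k.2)%MM)
  ((F t)@_k.1 * (F' t)@_k.2).
apply: (@tends_ext S) => [t|]; first by rewrite mcoeffM.
by apply: tends_sum => k _; apply: tendsM.
Qed.

Lemma ptendsX n (F : T -> {mpoly K[n]}) G d :
  ptends F G -> ptends (fun t => F t ^+ d) (G ^+ d).
Proof.
move=> FG; elim: d => [|d IHd]; first exact: ptends_cst.
rewrite exprS; apply: (ptends_ext _ (ptendsM FG IHd)) => t.
by rewrite exprS.
Qed.

Lemma ptends_prod n (I : Type) (s : seq I) (F : I -> T -> {mpoly K[n]}) G :
  (forall i, ptends (F i) (G i)) ->
  ptends (fun t => \prod_(i <- s) F i t) (\prod_(i <- s) G i).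
Proof.
move=> FG; elim: s => [|i s IHs].
  by rewrite big_nil; apply: (ptends_ext _ (ptends_cst 1)) => t; rewrite big_nil.
by rewrite big_cons; apply: (ptends_ext _ (ptendsM (FG i) IHs)) => t; rewrite big_cons.
Qed.

Lemma ptends_lf n (v : T -> 'rV[K]_n) v' : mtends v v' -> ptends (fun t => lf (v t)) (lf v').
Proof. by move=> vv; apply: ptends_sum => i _; apply: ptendsZ => //; apply: ptends_cst. Qed.

Lemma ptends_dd n (a : T -> 'rV[K]_n) (a' : 'rV[K]_n) F G :
  mtends a a' -> ptends F G -> ptends (fun t => dd (a t) (F t)) (dd a' G).
Proof.
move=> aa FG m; rewrite mcoeff_dd.
apply: (@tends_ext (fun t => \sum_i a t 0 i * ((F t)@_(m + U_(i)) *+ (m i).+1))).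
  by move=> t; rewrite mcoeff_dd.
by apply: tends_sum => i _; apply: tendsM => //; apply: tendsMn.
Qed.

Lemma ptends_homog n d (F : T -> {mpoly K[n]}) G :
  (forall t, F t \is d.-homog) -> ptends F G -> G \is d.-homog.
Proof.
move=> hF FG; apply/dhomogP => m; rewrite mcoeff_msupp => Gm; apply/eqP.
apply: contraNT Gm => md; apply/eqP; apply: tends_uniq (FG m) _.
by apply: (tends_ext _ (tends_cst 0)) => t; rewrite (dhomog_nemf_coeff (hF t) md).
Qed.

(* [a - (dot (v i) a / dot (v i) b) *: b] tends to [a] and is orthogonal to
   [v i], so differentiating along it removes the [i]-th summand. *)
Lemma killed_limit n (I : eqType) (s : seq I) (v : I -> T -> 'rV[K]_n) (P : I -> 'rV[K]_n)
    (c : I -> T -> K) l d F G :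
  {in s, forall i, [/\ mtends (v i) (P i), P i != 0 &
                       forall a, dot l a = 0 -> dot (P i) a = 0]} ->
  (\forall t \near U, F t = \sum_(i <- s) c i t *: lf (v i t) ^+ d) ->
  ptends F G -> killed (size s) l G.
Proof.
elim: s c d F G => [|i s IHs] c d F G HP HF FG.
  apply: (ptends_uniq FG) => m; apply: tends_near (tends_cst _).
  by apply: filterS HF => t ->; rewrite big_nil.
move=> a la; have [viP Pi0 Pil] := HP i (mem_head i s).
have [b Pib] := dot_unit Pi0.
pose q t := dot (v i t) a / dot (v i t) b.
have q0 : tends U q 0.
  rewrite -(Pil a la) -[dot _ a]divr1 -Pib; apply: tendsM; first exact: tends_dot.
  by apply: tendsV; [rewrite Pib oner_eq0 | apply: tends_dot].
pose a_ t := a - q t *: b.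
have aa : mtends a_ a.
  move=> j k; rewrite -[a j k]subr0 -(mul0r (b j k)).
  apply: (@tends_ext (fun t => a j k - q t * b j k)) => [t|]; first by rewrite !mxE.
  by apply: tendsB; [apply: tends_cst | apply: tendsM => //; apply: tends_cst].
(* The coefficients may diverge, since only [F] has to converge; they absorb the scalars produced by
   differentiation. *)
apply: (IHs (fun j t => c j t * (d%:R * dot (v j t) (a_ t))) d.-1 (fun t => dd (a_ t) (F t))).
- by move=> j js; apply: HP; rewrite inE js orbT.
- have nb : \forall t \near U, dot (v i t) b != 0.
    by apply: (tends_near_neq0 (oner_neq0 K)); rewrite -Pib; apply: tends_dot.
  apply: filterS2 HF nb => t -> vb.
  rewrite big_cons raddfD /= raddf_sum linearZ /= dd_lfX.
  have -> : dot (v i t) (a_ t) = 0 by rewrite dotB dotZ divfK // subrr.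
  rewrite mulr0 scale0r scaler0 add0r; apply: eq_bigr => j _.
  by rewrite linearZ /= dd_lfX scalerA.
- exact: ptends_dd.
Qed.

(** This is the compactness that replaces passing to subsequences; [ultra_bounded_tends] provides it
    for ultrafilters over the complex numbers. *)
Hypothesis bounded_tends :
  forall (z : T -> K) (M : K), (forall t, `|z t| <= M) -> exists l, tends U z l.

Lemma mtends_bounded m n (A : T -> 'M[K]_(m, n)) M :
  (forall t i j, `|A t i j| <= M) -> exists B, mtends A B.
Proof.
move=> AM; have HB (ij : 'I_m * 'I_n) : exists l, tends U (fun t => A t ij.1 ij.2) l.
  by apply: (bounded_tends (M := M)) => t; apply: AM.
have [B BP] := fin_all_exists HB; exists (\matrix_(i, j) B (i, j)) => i j.
by rewrite mxE; apply: (BP (i, j)).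
Qed.

Lemma ptends_bounded n d (F : T -> {mpoly K[n]}) M :
  (forall t, F t \is d.-homog) -> (forall t m, `|(F t)@_m| <= M) ->
  exists2 G, ptends F G & G \is d.-homog.
Proof.
move=> hF FM; have HG m : exists l, tends U (fun t => (F t)@_m) l.
  by apply: (bounded_tends (M := M)) => t; apply: FM.
have [g gP] := choice HG; pose G := \sum_(m : 'X_{1..n < d.+1}) g m *: 'X_[m].
have FG : ptends F G.
  move=> m; have [md|md] := ltnP (mdeg m) d.+1; first by rewrite mcoeff_mpoly.
  have Z t : (F t)@_m = 0 by rewrite (dhomog_nemf_coeff (hF t)) //= gtn_eqF.
  suff -> : G@_m = 0 by apply: (tends_ext _ (tends_cst 0)) => t; rewrite Z.
  rewrite (raddf_sum (mcoeff m)) big1 // => k _ /=; rewrite mcoeffZ mcoeffX.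
  case: eqP => [km|]; last by rewrite mulr0.
  by have := bmdeg k; rewrite km ltnNge md.
by exists G => //; apply: ptends_homog FG.
Qed.

(** In a fixed degree the substitution is a sum over a finite set of monomials independent of [t],
    each term being continuous in [B] and [F]. *)
Lemma ptends_sub n k d (B : T -> 'M[K]_(n, k)) B' F G :
  (forall t, F t \is d.-homog) -> mtends B B' -> ptends F G ->
  ptends (fun t => sub (B t) (F t)) (sub B' G).
Proof.
move=> hF BB FG; have hG := ptends_homog hF FG.
have subE (C : 'M[K]_(n, k)) p : p \is d.-homog -> sub C p =
    \sum_(m : 'X_{1..n < d.+1}) p@_m *: \prod_i lf (row i C) ^+ m i.
  move=> hp; rewrite /sub (comp_mpolywE _ (homog_msize_le hp)).
  apply: eq_bigr => m _; congr (_ *: _); apply: eq_bigr => i _.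
  by rewrite tnth_map tnth_ord_tuple.
rewrite subE //; apply: (ptends_ext (fun t => esym (subE (B t) (F t) (hF t)))).
apply: ptends_sum => m _; apply: ptendsZ; first exact: FG.
apply: ptends_prod => // i; apply: ptendsX => //; apply: ptends_lf => // i' j.
by rewrite mxE; apply: (tends_ext _ (BB i j)) => t; rewrite mxE.
Qed.

(** The matrices given by [compression] have entries bounded by 1, so they converge, and the
    identities they satisfy pass to the limit. Thus [G] depends on [size s] variables even if the
    limits of the [v i] become dependent. *)
Lemma compression_limit n (I : eqType) (s : seq I) (v : I -> T -> 'rV[K]_n)
    (c : I -> T -> K) d F G :
  (forall t, F t = \sum_(i <- s) c i t *: lf (v i t) ^+ d) -> ptends F G ->
  exists (B' : 'M[K]_(n, size s)) (B : 'M[K]_(size s, n)),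
    sub (B' *m B) G = G /\
    {in s, forall i P, mtends (v i) P -> P *m (B' *m B) = P}.
Proof.
move=> FE FG; pose V t := \matrix_(k < size s) v (tnth (in_tuple s) k) t.
have [B'_ HB'] := choice (fun t => compression (V t)).
have [B_ HB] := choice HB'.
have [B' BB'] : exists B', mtends B'_ B'.
  by apply: (mtends_bounded (M := 1)) => t i j; have [H _ _] := HB t.
have [B BB] : exists B, mtends B_ B.
  by apply: (mtends_bounded (M := 1)) => t i j; have [_ H _] := HB t.
have vB i t : i \in s -> v i t *m (B'_ t *m B_ t) = v i t.
  move=> si; have /tnthP[k ->] : i \in in_tuple s by [].
  have [_ _ VB] := HB t.
  by have := congr1 (row k) VB; rewrite row_mul rowK.
exists B', B; split=> [|i si P vP].
  apply: (ptends_uniq _ FG).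
  have hF t : F t \is d.-homog.
    by rewrite FE; apply: rpred_sum => i _; apply: rpredZ; apply: lfX_homog.
  apply: (ptends_ext _ (ptends_sub hF (mtends_mul BB' BB) FG)) => t.
  rewrite FE sub_sum; apply: eq_big_seq => i si.
  by rewrite subZ subXn sub_lf vB.
apply: (mtends_uniq _ vP).
have := mtends_mul vP (mtends_mul BB' BB).
by rewrite (_ : (fun t => _) = v i) //; apply/funext => t; apply: vB.
Qed.

(* Forms are grouped by the limits of their projective classes.  The partial
   sums of the groups may diverge, so they are all multiplied by [w], chosen so
   that the limits [G k] exist and do not vanish simultaneously with
   [lam = lim w]. *)
Lemma local_decomposition N n r d (l : T -> 'I_r -> 'rV[K]_n) (f : {mpoly K[n]}) :
  local_bound K N -> (0 < n)%N -> (0 < d)%N -> (r <= d.+1)%N ->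
  ptends (fun t => \sum_(k < r) lf (l t k) ^+ d) f ->
  exists2 q : 'I_r -> nat, (\sum_k q k = r)%N &
    powsum d f (\sum_(k < r | 0 < q k) N (q k) * d)%N.
Proof.
move=> HN n0 d0 rd lf_f.
have norm tk := normalize (l tk.1 tk.2) n0; have [cv Hcv] := choice norm.
pose c i t := (cv (t, i)).1; pose v i t := (cv (t, i)).2.
have lE t i : l t i = c i t *: v i t by have [] := Hcv (t, i).
have v1 t i : \sum_j `|v i t 0 j| = 1 by have [] := Hcv (t, i).
have [P vP] : exists P : 'I_r -> 'rV[K]_n, forall i, mtends (v i) (P i).
  suff H i : exists Q, mtends (v i) Q by exact: fin_all_exists H.
  apply: (mtends_bounded (M := 1)) => t k j.
  rewrite ord1 -(v1 t i) (bigD1 j) //= lerDl; exact: sumr_ge0.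
(* The normalization to norm 1 survives in the limit. *)
have P0 i : P i != 0.
  apply: contra_neq (oner_neq0 K) => Pi0.
  have : tends U (fun t => \sum_j `|v i t 0 j|) (\sum_j `|P i 0 j|).
    by apply: tends_sum => j _; apply: tends_norm; apply: vP.
  rewrite (_ : (fun t => _) = fun=> 1); last by apply/funext => t; apply: v1.
  rewrite Pi0 big1 => [|j _]; last by rewrite mxE normr0.
  by apply: tends_uniq; apply: tends_cst.
(* [<<P i>>%MS] is a canonical generator of the line through [P i], so the index picked depends only
   on that line. The search succeeds at [i] at the latest. *)
pose rep (i : 'I_r) : 'I_r := odflt i [pick j | <<P j>>%MS == <<P i>>%MS].
have repE i : <<P (rep i)>>%MS = <<P i>>%MS.
  by rewrite /rep; case: pickP => [j /eqP //|].
have rep_eq i j : <<P i>>%MS = <<P j>>%MS -> rep i = rep j.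
  move=> ij; rewrite /rep ij; case: pickP => // /(_ j); by rewrite eqxx.
have prop i j : <<P i>>%MS = <<P j>>%MS -> exists a, P i = a *: P j.
  by move=> ij; apply/sub_rVP; rewrite -genmxE ij genmxE.
pose s (k : 'I_r) : seq 'I_r := [seq i <- index_enum 'I_r | rep i == k].
pose q (k : 'I_r) := size (s k).
have sumq : (\sum_k q k = r)%N.
  rewrite -[RHS]card_ord -sum1_card [RHS](partition_big rep xpredT) //=.
  by apply: eq_bigr => k _; rewrite /q /s size_filter -sum1_count.
exists q => //.
have qrep k : (0 < q k)%N -> rep k = k.
  rewrite /q; case sk : (s k) => [//|i s'] _; have : i \in s k by rewrite sk mem_head.
  rewrite mem_filter => /andP[/eqP ik _].
  by rewrite -[in RHS]ik; apply: rep_eq; rewrite -ik repE.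
pose F k t := \sum_(i <- s k) c i t ^+ d *: lf (v i t) ^+ d.
have hF k t : F k t \is d.-homog.
  by apply: rpred_sum => i _; apply: rpredZ; apply: lfX_homog.
have sumF t : \sum_k F k t = \sum_(k < r) lf (l t k) ^+ d.
  rewrite [RHS](partition_big rep xpredT) //=; apply: eq_bigr => k _.
  by rewrite /F big_filter; apply: eq_bigr => i _; rewrite lE lfZ exprZn.
(* The total size of all groups. Rescaling by the inverse of [1 + A t] bounds every coefficient by
   1, and the summand 1 keeps the denominator positive. *)
pose A t := \sum_k \sum_(m : 'X_{1..n < d.+1}) `|(F k t)@_m|.
have A0 t : 0 <= A t by apply: sumr_ge0 => k _; apply: sumr_ge0.
have A1 t : 0 < 1 + A t by rewrite ltr_pwDl.
pose w t := (1 + A t)^-1.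
have w0 t : 0 <= w t by rewrite invr_ge0 ltW.
have w1 t : w t * (1 + A t) = 1 by rewrite mulVf // gt_eqF.
have [lam wlam] : exists lam, tends U w lam.
  apply: (bounded_tends (M := 1)) => t; rewrite ger0_norm // invf_le1 //.
  by rewrite lerDl.
have hwF k t : w t *: F k t \is d.-homog by apply: rpredZ.
have wF1 k t m : `|(w t *: F k t)@_m| <= 1.
  rewrite mcoeffZ normrM ger0_norm // -(w1 t) ler_wpM2l //.
  have [md|md] := ltnP (mdeg m) d.+1; last first.
    by rewrite (dhomog_nemf_coeff (hF k t)) ?normr0 ?ltW //= gtn_eqF.
  apply: (@le_trans _ _ (A t)); last by rewrite lerDr.
  rewrite /A (bigD1 k) //= (bigD1 (BMultinom md)) //= -addrA lerDl.
  by rewrite addr_ge0 //; apply: sumr_ge0 => // k' _; apply: sumr_ge0.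
have /fin_all_exists2[G wFG hG] : forall k,
    exists2 G, ptends (fun t => w t *: F k t) G & G \is d.-homog.
  by move=> k; apply: (ptends_bounded (M := 1)).
have sumG : \sum_k G k = lam *: f.
  apply: (ptends_uniq _ (ptendsZ wlam lf_f)).
  apply: (@ptends_ext _ (fun t => \sum_k w t *: F k t)); last first.
    by apply: ptends_sum.
  by move=> t; rewrite -scaler_sumr sumF.
(* The limit of the identity [w t * (1 + A t) = 1]. *)
have sumG1 : lam + \sum_k \sum_(m : 'X_{1..n < d.+1}) `|(G k)@_m| = 1.
  apply: (@tends_uniq (fun=> 1)); last exact: tends_cst.
  pose S t := w t + \sum_k \sum_(m : 'X_{1..n < d.+1}) `|(w t *: F k t)@_m|.
  apply: (@tends_ext S) => [t|].
    rewrite -(w1 t) mulrDr mulr1 /A mulr_sumr; congr (_ + _); apply: eq_bigr => k _.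
    by rewrite mulr_sumr; apply: eq_bigr => m _; rewrite mcoeffZ normrM ger0_norm.
  apply: tendsD => //; apply: tends_sum => k _; apply: tends_sum => m _.
  by apply: tends_norm; apply: wFG.
have wFE k t : w t *: F k t = \sum_(i <- s k) (w t * c i t ^+ d) *: lf (v i t) ^+ d.
  by rewrite scaler_sumr; apply: eq_bigr => i _; rewrite scalerA.
have KG k : killed (q k) (P k) (G k).
  apply: (@killed_limit _ _ (s k) v P _ _ d _ _ _ (nearW _ (wFE k)) (wFG k)).
  move=> i; rewrite mem_filter => /andP[/eqP ik _]; split=> // a Pka.
  have [b ->] : exists b, P i = b *: P k by apply: prop; rewrite -ik repE.
  by rewrite /dot; under eq_bigr do rewrite mxE -mulrA; rewrite -mulr_sumr [X in _ * X]Pka mulr0.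
(* Were [lam] zero, the [G k] would sum to zero and vanish by [killed_indep], contradicting
   [sumG1]. *)
have lam0 : lam != 0.
  apply: contra_neq (oner_neq0 K) => lam0; rewrite -sumG1 lam0 add0r.
  rewrite big1 // => k _; rewrite big1 // => m _.
  rewrite (@killed_indep _ _ _ d q P G) ?mcoeff0 ?normr0 ?sumq //; last first.
    by rewrite sumG lam0 scale0r.
  move=> i j ij qi qj; have [b Pb] := dot_unit (P0 i).
  (* If this vector were zero, [P i] and [P j] would span the same line and [i], [j] would be the
     same representative. Making [a] orthogonal to [P i] then gives the separating direction. *)
  have [a wa] : exists a, dot (P j - dot (P j) b *: P i) a = 1.
    apply: dot_unit; apply: contra_neq ij => /eqP; rewrite subr_eq0 => /eqP Pj.
    rewrite -(qrep i qi) -(qrep j qj); apply: rep_eq; apply/genmxP.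
    have x0 : dot (P j) b != 0.
      by apply: contra_neq (P0 j) => x0; rewrite Pj x0 scale0r.
    by rewrite Pj; apply/eqmxP; apply: eqmx_sym; apply: eqmx_scale.
  exists (a - dot (P i) a *: b); rewrite !dotB !dotZ Pb mulr1 subrr; split=> //.
  by rewrite -[RHS]wa [RHS]dotC dotB dotZ !(dotC a) mulrC.
have -> : f = \sum_(k < r | (0 < q k)%N) lam^-1 *: G k.
  rewrite -scaler_sumr -[LHS]scale1r -(mulVf lam0) -scalerA -sumG.
  rewrite (bigID (fun k => 0 < q k)%N) /= [X in _ + X]big1 ?addr0 // => k.
  by rewrite -eqn0Ngt => /eqP qk; have := KG k; rewrite qk.
apply: powsum_sum => k qk; apply: powsumZ => //.
have [B' [B [BG BP]]] := compression_limit (wFE k) (wFG k).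
apply: (local_rank (l := P k) HN d0 _ (P0 k) (hG k) (KG k) BG).
  rewrite qk (leq_trans _ rd) // -[X in (_ <= X)%N]sumq.
  by rewrite (bigD1 k) //= leq_addr.
by apply: (BP k _ _ (vP k)); rewrite mem_filter mem_index_enum (qrep k qk) eqxx.
Qed.

(** All [r] linear forms are compressed as a single group; the resulting form in [r] variables is
    then integrated up to degree [r.-1], where [N r] applies. *)
Lemma integrated_rank N n r d (l : T -> 'I_r -> 'rV[K]_n) (f : {mpoly K[n]}) :
  local_bound K N -> (0 < d)%N -> (d.+1 < r)%N ->
  ptends (fun t => \sum_(k < r) lf (l t k) ^+ d) f -> powsum d f (N r).
Proof.
move=> [_ HN] d0 dr lf_f.
have [|B' [B [Bf _]]] :=
    @compression_limit _ _ (index_enum 'I_r) (fun i t => l t i) (fun _ _ => 1) d _ _ _ lf_f.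
  by move=> t; apply: eq_bigr => i _; rewrite scale1r.
have hf : f \is d.-homog.
  by apply: ptends_homog lf_f => t; apply: rpred_sum => i _; apply: lfX_homog.
have sr : size (index_enum 'I_r) = r by rewrite -sum1_size sum1_card card_ord.
rewrite -Bf -sub_sub; apply: powsum_sub; move: B' B Bf; rewrite sr => B' B _.
(* From here on [r] is one less than the number of linear forms, that is, the degree to be reached
   by integration in the variable [ord0]. *)
case: r dr HN {l lf_f sr} B' B => // r dr HN B' _.
apply: (@powsum_integral _ _ ord0 d (r - d)) (sub_homog B' hf) => //.
have dr' : (d <= r)%N by apply: ltnW.
by rewrite subnKC // => h hh; apply: HN => //; apply: leq_ltn_trans dr.
Qed.

End Limits.

(** * The complex case *)

Section Complex.
Local Open Scope classical_set_scope.
Variable R : realType.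

(** Real and imaginary parts stay in a compact segment, so their images of [U] have cluster points,
    and a cluster point of an ultrafilter is a limit. *)
Lemma ultra_bounded_tends (T : Type) (U : set_system T) (z : T -> R[i]) (M : R[i]) :
  UltraFilter U -> (forall t, `|z t| <= M) -> exists l, tends U z l.
Proof.
move=> UU zM.
have M0 : 0 <= M.
  have /filter_ex [t _] : U setT by exact: filterT.
  exact: le_trans (normr_ge0 _) (zM t).
have bnd (h : T -> R) : (forall t, `|(h t)%:C%C| <= M) -> exists a : R, h @ U --> a.
  move=> hM; set m := complex.Re M.
  have sub : [set: T] `<=` h @^-1` `[- m, m]%classic.
    move=> t _ /=; rewrite in_itv /= -ler_norml.
    by have := hM t; rewrite normc_def /= lecE /= expr0n addr0 sqrtr_sqr => /andP[].
  have [|a [_ cla]] := @segment_compact R (- m) m (h @ U) _.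
    exact: (filterS sub filterT).
  exists a => B Ba; have [//|UB] := in_ultra_setVsetC (h @^-1` B) UU.
  by have [x []] := cla (~` B) B UB Ba.
have [t|a ha] := bnd (fun t => complex.Re (z t)).
  apply: le_trans (zM t); have := normc_ge_Re (z t).
  by rewrite [X in _ -> X <= _]normc_def /= expr0n addr0 sqrtr_sqr.
have [t|b hb] := bnd (fun t => complex.Im (z t)).
  (* The imaginary part of [z t] is the real part of [- ('i * z t)], which has the same modulus. *)
  apply: le_trans (zM t); have := normc_ge_Re (- ('i%C * z t)).
  rewrite [X in _ -> X <= _]normc_def /= expr0n addr0 sqrtr_sqr normrN normrM.
  have -> : `|'i%C : R[i]| = 1 by rewrite normc_def /= expr0n add0r expr1n sqrtr1.
  rewrite mul1r; apply: le_trans; rewrite lecE eqxx /=.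
  by case: (z t) => x y /=; rewrite !mul0r !mul1r sub0r opprK.
exists (a +i* b)%C; apply/cvgrPdist_lt => e e0.
have e2 : 0 < complex.Re e / 2.
  by rewrite divr_gt0 ?ltr0n //; move: e0; rewrite ltcE => /andP[].
have/cvgrPdist_lt/(_ _ e2) Ha := ha.
have/cvgrPdist_lt/(_ _ e2) Hb := hb.
apply: filterS2 Ha Hb => t Hx Hy.
have -> : (a +i* b)%C - z t =
   (a - complex.Re (z t))%:C%C + 'i%C * (b - complex.Im (z t))%:C%C.
  case: (z t) => x y; apply/eqP; rewrite eq_complex /=.
  by rewrite !(mul0r, mul1r, subr0, mulr0, addr0, add0r, subrr) !eqxx.
apply: le_lt_trans (ler_normD _ _) _; rewrite normrM.
have -> : `|'i%C : R[i]| = 1 by rewrite normc_def /= expr0n add0r expr1n sqrtr1.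
rewrite mul1r !normc_def /= expr0n !addr0 !sqrtr_sqr.
move: e0; rewrite !ltcE /= => /andP[/eqP -> _]; rewrite addr0 eqxx /=.
by rewrite (splitr (complex.Re e)) ltrD.
Qed.

(** Refining the punctured neighbourhoods of 0 to an ultrafilter keeps the limit [f] and makes every
    bounded function converge. *)
Lemma border_ultra (n d r : nat) (f : {mpoly R[i][n]}) :
  border_waring_dec d f r ->
  exists (U : set_system R[i]) (l : R[i] -> 'I_r -> 'I_n -> R[i]),
    UltraFilter U /\ forall m, tends U (fun e => (\sum_(k < r) lin_form (l e k) ^+ d)@_m) f@_m.
Proof.
case=> p [q] [_ lim].
have PF : ProperFilter ((0 : R[i])^') by exact: (@Proper_dnbhs_numFieldType R[i] (0 : R[i])).
have [U [UU sU]] := ultraFilterLemma PF.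
exists U, (fun e k i => (p k i).[e] / (q k i).[e]); split=> // m.
apply: cvg_trans (lim m).
by apply: cvg_app.
Qed.
End Complex.

(** * Ranks as minima and maxima, and the final bound *)

Lemma min_natP (P : nat -> Prop) k : P k -> P (min_nat P) /\ (min_nat P <= k)%N.
Proof.
move=> Pk; suff [] : P (min_nat P) /\ (forall m, P m -> min_nat P <= m)%N by split; auto.
apply: (@xgetPex _ 0%N [set k | P k /\ forall m, P m -> (k <= m)%N]%classic).
have ex : exists n, `[< P n >] by exists k; apply/asboolP.
by exists (ex_minn ex); case: ex_minnP => m /asboolP Pm le_m; split=> // j /asboolP /le_m.
Qed.

(** The bound [b] excludes the default value 0 of [lub_nat]. *)
Lemma leq_lub_nat (P : nat -> Prop) b m :
  (forall k, P k -> (k <= b)%N) -> P m -> (m <= lub_nat P)%N.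
Proof.
move=> Pb Pm; suff [] : (forall k, P k -> (k <= lub_nat P)%N) /\
    (forall c, (forall k, P k -> (k <= c)%N) -> (lub_nat P <= c)%N) by move=> /(_ m Pm).
apply: (@xgetPex _ 0%N [set k | (forall m, P m -> (m <= k)%N) /\
                    forall b, (forall m, P m -> (m <= b)%N) -> (k <= b)%N]%classic).
have ex : exists c, `[< forall k, P k -> (k <= c)%N >] by exists b; apply/asboolP.
by exists (ex_minn ex); case: ex_minnP => c /asboolP Pc le_c; split=> // j /asboolP /le_c.
Qed.

Section WaringRank.
Local Open Scope classical_set_scope.
Variable R : realType.
Implicit Types (n d r : nat).

Lemma lin_formE n (l : 'I_n -> R[i]) : lin_form l = lf (\row_i l i).
Proof. by apply: eq_bigr => i _; rewrite mxE. Qed.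

Lemma waring_decP n d (h : {mpoly R[i][n]}) N : waring_dec d h N <-> powsum d h N.
Proof.
split=> [[l ->]|[s <- ->]].
  exists [seq \row_i l k i | k <- index_enum 'I_N].
    by rewrite size_map -sum1_size sum1_card card_ord.
  by rewrite big_map; apply: eq_bigr => k _; rewrite lin_formE.
exists (fun k => (tnth (in_tuple s) k) 0); rewrite (big_tnth _ _ s).
apply: eq_bigr => k _; rewrite lin_formE; congr (lf _ ^+ _).
by apply/rowP => i; rewrite mxE.
Qed.

Lemma WR_le n d (h : {mpoly R[i][n]}) N : powsum d h N -> (WR d h <= N)%N.
Proof. by move=> /waring_decP /min_natP[]. Qed.

Lemma powsum_WR n d (h : {mpoly R[i][n]}) : (0 < d)%N -> h \is d.-homog -> powsum d h (WR d h).
Proof.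
move=> d0 hh; have [N HN] := homog_powsum_bound R[i] n d0.
by apply/waring_decP; have /waring_decP/min_natP[] := HN h hh.
Qed.

(** A Waring decomposition, viewed as a constant family, is a border decomposition, so the minimum
    is attained. *)
Lemma border_waring_dec_BWR n d (h : {mpoly R[i][n]}) :
  (0 < d)%N -> h \is d.-homog -> border_waring_dec d h (BWR d h).
Proof.
move=> d0 hh; have [l hl] := (waring_decP _ _ _).2 (powsum_WR d0 hh).
have : border_waring_dec d h (WR d h).
  exists (fun k i => (l k i)%:P), (fun _ _ => 1); split=> [k i|m]; first exact: oner_neq0.
  rewrite [X in X @ _](_ : _ = fun=> h@_m); first exact: cvg_cst.
  apply/funext => e; rewrite [in RHS]hl; congr (_ @_ m); apply: eq_bigr => k _.
  congr (lin_form _ ^+ _); apply/funext => i.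
  by rewrite hornerC hornerC divr1.
by move=> /min_natP[].
Qed.

(** The value at 1 is positive by the convention that [maxR] is 1 in degree 0. *)
Lemma maxR_local_bound : local_bound R[i] (fun q => maxR R q q.-1).
Proof.
split=> // q h q1 hh; have q0 : (0 < q.-1)%N by lia.
apply: (powsumW q0) (powsum_WR q0 hh).
rewrite /maxR; case: q.-1 q0 hh => // e _ hh.
have [N HN] := homog_powsum_bound R[i] q (ltn0Sn e).
apply: (@leq_lub_nat _ N) => [k [g [hg <-]]|]; last by exists h.
by apply: WR_le; apply: HN.
Qed.

Lemma leq_Mpart (s : seq nat) :
  all (fun x => 0 < x)%N s -> (\sum_(x <- s) maxR R x x.-1 <= Mpart R (sumn s))%N.
Proof.
(* Boundedness over all partitions: a part [x] is positive and at most the total, so it contributes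
   at most [x] times the largest [maxR] in that range. *)
move=> s0; apply: (@leq_lub_nat _ (sumn s * \max_(x < (sumn s).+1) maxR R x x.-1)%N).
  move=> k [t [t0 ts ->]]; rewrite -ts sumnE sumnE big_map mulnC big_distrr /=.
  rewrite big_seq [X in (_ <= X)%N]big_seq; apply: leq_sum => x xt.
  have xb : (x < (sumn t).+1)%N.
    by rewrite ltnS sumnE (big_rem x) //= leq_addr.
  rewrite -[X in (X <= _)%N]muln1; apply: leq_mul; last exact: (allP t0).
  by rewrite -sumnE; exact: (@leq_bigmax _ (fun y : 'I__ => maxR R y y.-1) (Ordinal xb)).
by exists s; split; rewrite // sumnE big_map.
Qed.

End WaringRank.

Unset Implicit Arguments.

Theorem theorem13 (R : realType) (n d r : nat) (f : {mpoly R[i][n]}) :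
  (0 < d)%N -> f \is d.-homog -> BWR d f = r ->
  (WR d f <= Mpart R r * d)%N.
Proof.
move=> d0 hf rE; have := border_waring_dec_BWR d0 hf; rewrite {}rE.
case/border_ultra => U [l [UU lim]].
have FU : ProperFilter U by exact: ultra_proper.
have bnd (z : R[i] -> R[i]) (M : R[i]) :
    (forall t, `|z t| <= M) -> exists a, tends U z a by exact: ultra_bounded_tends.
pose v e k : 'rV[R[i]]_n := \row_i l e k i.
have vf : ptends U (fun e => \sum_(k < r) lf (v e k) ^+ d) f.
  move=> m; apply: (tends_ext _ (lim m)) => e; congr (_ @_ m); apply: eq_bigr => k _.
  by rewrite lin_formE.
have HN := maxR_local_bound R.
(* Without variables there are no unit vectors to normalize to, but a form of positive degree is
   then zero. *)
have [n0|n_gt0] := posnP n.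
  suff f0 : f = 0.
    by apply: leq_trans (WR_le _) (leq0n _); rewrite f0; exact: powsum0.
  apply/mpolyP => m; rewrite mcoeff0 (dhomog_nemf_coeff hf) //= mdegE.
  by rewrite big1 ?neq_ltn ?d0 // => i _; have := leq_trans (ltn_ord i) (eq_leq n0).
have [rd|rd] := leqP r d.+1.
  have [q sumq fq] := local_decomposition FU bnd HN n_gt0 d0 rd vf.
  apply: leq_trans (WR_le fq) _; rewrite -big_distrl /= leq_mul2r; apply/orP; right.
  (* Dropping the empty groups leaves a partition of [r] into positive parts. *)
  pose s := [seq q k | k <- index_enum 'I_r & (0 < q k)%N].
  have -> : (\sum_(k < r | 0 < q k) maxR R (q k) (q k).-1 =
             \sum_(x <- s) maxR R x x.-1)%N by rewrite big_map big_filter.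
  have <- : sumn s = r.
    rewrite sumnE big_map big_filter -[RHS]sumq [RHS](bigID (fun k => 0 < q k)%N) /=.
    by rewrite [X in (_ + X)%N]big1 ?addn0 // => k; rewrite -eqn0Ngt => /eqP.
  by apply: leq_Mpart; apply/allP => x /mapP[k]; rewrite mem_filter => /andP[qk _] ->.
apply: leq_trans (WR_le (integrated_rank FU bnd HN d0 rd vf)) _.
apply: (@leq_trans (Mpart R r)); last by rewrite leq_pmulr.
(* The partition of [r] with a single part. *)
have := @leq_Mpart R [:: r]; rewrite /= big_seq1 addn0; apply.
by rewrite (leq_ltn_trans _ rd).
Qed.
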